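(* Let $z \in \Omega_1$ and let $z' \in \Gamma_z$ be in the orbit of $z$. Let $\gamma$ and $\gamma'$ be the largest interior angles of the triangles defined by $z$ and $z'$, respectively. Then, with the constant (not depending on $z$ or $z'$) $$c=\frac{\arccos\left(\frac{-5}{2\sqrt{7}}\right)}{\pi/3}\approx 2.6816,$$ one has $\gamma' \leq c\,\gamma$.
   Context: Space of triangles: $\Sigma = \{ z\in\mathbb{C} : \operatorname{Im}(z) > 0,\ \operatorname{Re}(z)\leq 1/2,\ |z-1|\leq 1\}$. A point $z\in\Sigma$ defines the triangle with vertices $0$, $1$, $z$; here the segment from $0$ to $1$ is a longest edge and the segment from $0$ to $z$ is a shortest edge. Every nondegenerate triangle is similar (orientation-reversing similarities allowed) to the triangle defined by exactly one $w\in\Sigma$, called its normalized form. Longest edge trisection (LE3): the longest edge is divided into three equal parts and the two division points are joined to the opposite vertex. For $z\in\Sigma$ this gives the left triangle with vertices $0,\tfrac13,z$, the middle triangle with vertices $\tfrac13,\tfrac23,z$ and the right triangle with vertices $\tfrac23,1,z$. Let $W_{\mathrm L}(z), W_{\mathrm M}(z), W_{\mathrm R}(z)\in\Sigma$ be the normalized forms of the left, middle and right triangle, respectively. The orbit $\Gamma_z$ of $z$ is the smallest subset of $\Sigma$ that contains $z$ and is closed under $W_{\mathrm L}, W_{\mathrm M}, W_{\mathrm R}$. Hyperbolic metric: the upper half-plane $\{\operatorname{Im} z>0\}$ carries the Poincaré metric, whose distance $d$ is given by $\cosh d(z_1,z_2)= 1+\frac{|z_1-z_2|^2}{2\operatorname{Im}(z_1)\operatorname{Im}(z_2)}$.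 Geodesics are vertical lines and circular arcs centred on the real axis. Circles: let $\omega_1=\frac13+\frac{\sqrt2}{3}i$, $\omega_2=\frac13+\frac{\sqrt2}{6}i$, $\omega_3=\frac49+\frac{\sqrt2}{9}i$. For $j=1,2,3$ let $C_j$ be the hyperbolic circle with hyperbolic centre $\omega_j$ and hyperbolic radius $\ln(\sqrt2)$, and let $D_j=\{z: d(z,\omega_j)\le \ln\sqrt2\}$ be the closed disc it bounds. The region $\Omega_1$: let $z_{\mathrm{eq}}=\frac12+\frac{\sqrt3}{2}i$ (the equilateral triangle) and $\Gamma_{\mathrm{eq}}=\Gamma_{z_{\mathrm{eq}}}$ its orbit. From each point $p\in\Gamma_{\mathrm{eq}}$ lying outside $D_1\cup D_2\cup D_3$, trace the geodesics through $p$ that are tangent to the circles $C_1,C_2,C_3$. For such $p$ and each $j\in\{1,2,3\}$, the cone from $p$ to $C_j$ is the region bounded by the two geodesics through $p$ tangent to $C_j$ and by $C_j$; together with $D_j$ it is the union of all geodesic segments joining $p$ to points of $D_j$. The set $\Omega_1\subset\Sigma$ is the union of $D_1, D_2, D_3$ and all these cones. *)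

(* Defs.v *)
From Stdlib Require Export Reals Lra.
From Coquelicot Require Export Coquelicot.

Local Open Scope R_scope.

(** * Triangles in the plane *)

(** Similarities of the plane; orientation may be reversed. *)
Definition similarity (f : C -> C) : Prop :=
  exists k : R, 0 < k /\
    forall x y : C, Cmod (f x - f y)%C = k * Cmod (x - y)%C.

(** The vertices of a triangle are not ordered. *)
Definition vertex (a b c x : C) : Prop := x = a \/ x = b \/ x = c.

Definition similar_triangles (a b c a' b' c' : C) : Prop :=
  exists f : C -> C, similarity f /\
    forall y : C,
      vertex a' b' c' y <-> exists x : C, vertex a b c x /\ y = f x.

Definition Sigma (z : C) : Prop :=
  0 < Im z /\ Re z <= 1 / 2 /\ Cmod (z - RtoC 1)%C <= 1.

(** For a nondegenerate triangle there is exactly one such [w], so this is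
    the graph of a function. *)
Definition normalized_form (a b c w : C) : Prop :=
  Sigma w /\ similar_triangles (RtoC 0) (RtoC 1) w a b c.

(** The graphs of [W_L], [W_M], [W_R]. *)
Definition WL (z w : C) : Prop :=
  normalized_form (RtoC 0) (RtoC (1 / 3)) z w.
Definition WM (z w : C) : Prop :=
  normalized_form (RtoC (1 / 3)) (RtoC (2 / 3)) z w.
Definition WR (z w : C) : Prop :=
  normalized_form (RtoC (2 / 3)) (RtoC 1) z w.

Inductive orbit (z : C) : C -> Prop :=
| orbit_base : orbit z z
| orbit_WL (u w : C) : orbit z u -> WL u w -> orbit z w
| orbit_WM (u w : C) : orbit z u -> WM u w -> orbit z w
| orbit_WR (u w : C) : orbit z u -> WR u w -> orbit z w.

(** Interior angle at [a] of the triangle [a], [b], [c], in radians;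
    [Re (u * Cconj v)] is the Euclidean inner product of [u] and [v]. *)
Definition angle (a b c : C) : R :=
  acos (Re ((b - a) * Cconj (c - a))%C / (Cmod (b - a)%C * Cmod (c - a)%C)).

Definition largest_angle (z : C) : R :=
  Rmax (angle (RtoC 0) (RtoC 1) z)
    (Rmax (angle (RtoC 1) z (RtoC 0)) (angle z (RtoC 0) (RtoC 1))).

(** * The hyperbolic upper half-plane *)

Definition arcosh (x : R) : R := ln (x + sqrt (x ^ 2 - 1)).

(** Meaningful only when both points lie in the upper half-plane. *)
Definition hdist (z w : C) : R :=
  arcosh (1 + Cmod (z - w)%C ^ 2 / (2 * Im z * Im w)).

Definition hdisc (o : C) (r : R) (z : C) : Prop :=
  0 < Im z /\ hdist z o <= r.

Definition between (a b x : R) : Prop := a <= x <= b \/ b <= x <= a.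

(** Points of the geodesic segment from [p] to [q]: the part between [p] and
    [q] of a vertical line, or of a half-circle with real centre [m]. *)
Definition geodesic_segment (p q z : C) : Prop :=
  0 < Im p /\ 0 < Im q /\ 0 < Im z /\
  ((Re p = Re q /\ Re z = Re p /\ between (Im p) (Im q) (Im z)) \/
   (exists m r : R, 0 < r /\
      Cmod (p - RtoC m)%C = r /\ Cmod (q - RtoC m)%C = r /\
      Cmod (z - RtoC m)%C = r /\ between (Re p) (Re q) (Re z))).

(** * The region *)

Definition omega1 : C := (1 / 3, sqrt 2 / 3).
Definition omega2 : C := (1 / 3, sqrt 2 / 6).
Definition omega3 : C := (4 / 9, sqrt 2 / 9).

Definition D1 : C -> Prop := hdisc omega1 (ln (sqrt 2)).
Definition D2 : C -> Prop := hdisc omega2 (ln (sqrt 2)).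
Definition D3 : C -> Prop := hdisc omega3 (ln (sqrt 2)).

Definition z_eq : C := (1 / 2, sqrt 3 / 2).

(** The disc [D] together with the cone from [p] to its boundary circle. *)
Definition cone_with_disc (p : C) (D : C -> Prop) (z : C) : Prop :=
  exists q : C, D q /\ geodesic_segment p q z.

Definition Omega1 (z : C) : Prop :=
  (D1 z \/ D2 z \/ D3 z) \/
  exists p : C, orbit z_eq p /\ ~ (D1 p \/ D2 p \/ D3 p) /\
    (cone_with_disc p D1 z \/ cone_with_disc p D2 z \/ cone_with_disc p D3 z).

Lemma cosh_arcosh (x : R) : 1 <= x -> cosh (arcosh x) = x.
Proof.
intros Hx; unfold arcosh, cosh.
assert (Hs : sqrt (x ^ 2 - 1) * sqrt (x ^ 2 - 1) = x ^ 2 - 1)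
  by (apply sqrt_sqrt; nra).
pose proof (sqrt_pos (x ^ 2 - 1)) as Hp.
rewrite exp_Ropp, exp_ln by lra.
field_simplify_eq; nra.
Qed.

Lemma cosh_hdist (z w : C) : 0 < Im z -> 0 < Im w ->
  cosh (hdist z w) = 1 + Cmod (z - w)%C ^ 2 / (2 * Im z * Im w).
Proof.
intros Hz Hw; apply cosh_arcosh.
assert (0 <= Cmod (z - w)%C ^ 2 / (2 * Im z * Im w)); [|lra].
apply Rmult_le_pos; [apply pow2_ge_0|].
apply Rlt_le, Rinv_0_lt_compat; nra.
Qed.

Lemma hdist_ge0 (z w : C) : 0 < Im z -> 0 < Im w -> 0 <= hdist z w.
Proof.
intros Hz Hw; unfold hdist, arcosh.
assert (0 <= Cmod (z - w)%C ^ 2 / (2 * Im z * Im w)) as H.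
{ apply Rmult_le_pos; [apply pow2_ge_0|].
  apply Rlt_le, Rinv_0_lt_compat; nra. }
set (t := 1 + _) in *.
pose proof (sqrt_pos (t ^ 2 - 1)).
rewrite <- ln_1; apply ln_le; unfold t in *; lra.
Qed.

(* Main.v *)
Require Import Defs.
From Stdlib Require Import Reals Lra Psatz.
From Coquelicot Require Import Coquelicot.

Open Scope R_scope.

(** The largest angle of a triangle is at least [PI / 3], so it suffices that
    no triangle in the orbit of a point of [Omega1] has an angle above
    [gamma_max], the numerator of the constant.  This is done by enclosing
    [Omega1] in a region that the three maps send into itself and in which
    all angles are at most [gamma_max].

    The coordinates [x = Re z] and [N = |z|^2] turn everything into affine
    geometry.  In the [(x, N)]-plane hyperbolic geodesics are straight
    segments ([geodesic_affine]), so hyperbolic half-planes are given by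
    affine inequalities in [x] and [N].  The squared side lengths of the three
    smaller triangles are affine in [x] and [N] as well, and normalizing a
    triangle only sorts them and divides by the largest
    ([normalized_form_sides]).  Hence each of [WL], [WM], [WR] is
    projective-linear on the set where the sides have a given order.

    The region [region or] is a polygon in the [(x, N)]-plane whose corners
    all lie in the orbit of [z_eq].  It is not convex: it is the convex hull
    of that orbit with two notches cut out, whose reflex corners are the
    points [1/6 + i sqrt 3/6] and [5/14 + i sqrt 3/14] of the orbit.  The
    notches cannot be filled: on the side of the hull above which the second
    one lies, the maps [WM] and [WR] fold across the circle [|z - 2/3| = 1/3]
    and would carry the side out of the hull; and [WR] carries the side of the
    first notch to that of the second.  With the notches, invariance is linear
    arithmetic over the orders of the sides ([trisection_trapped]).

    Every disc [D1], [D2], [D3] lies on the good side of all the lines that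
    bound the region, also of both lines at each reflex corner
    ([disc_core]).  So the region is star-shaped about these discs, and since
    it contains the orbit of [z_eq] it contains the cones ([Omega1_trapped]).

    Finally the angle at [z] exceeds [gamma_max] only below an arc through [0]
    and [1], which is a conic in the [(x, N)]-plane.  The set above it is
    convex and contains the corners of the region ([apex_cosine_bound]); the
    arc passes through the corner [29/62 + 3 sqrt 3/62 i], where the angle
    [gamma_max] is attained. *)

(** * Plane coordinates *)

Definition sqdist (u v : C) : R := Cmod (u - v)%C ^ 2.

Definition sqnorm (z : C) : R := Re z ^ 2 + Im z ^ 2.

Lemma sqdist_coords (u v : C) :
  sqdist u v = (Re u - Re v) ^ 2 + (Im u - Im v) ^ 2.
Proof. unfold sqdist; rewrite Cmod2_alt; destruct u, v; cbn; ring. Qed.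

Lemma sqdist_sym (u v : C) : sqdist u v = sqdist v u.
Proof. rewrite !sqdist_coords; ring. Qed.

Lemma sqdist_self (u : C) : sqdist u u = 0.
Proof. rewrite sqdist_coords; ring. Qed.

Lemma sqdist_real (z : C) (d : R) :
  sqdist z (RtoC d) = sqnorm z - 2 * d * Re z + d ^ 2.
Proof. rewrite sqdist_coords; unfold sqnorm; cbn; ring. Qed.

Lemma Sigma_coords (z : C) :
  Sigma z <-> 0 < Im z /\ 2 * Re z <= 1 /\ sqnorm z <= 2 * Re z.
Proof.
unfold Sigma; pose proof (sqdist_real z 1) as H; unfold sqdist in H.
pose proof (Cmod_ge_0 (z - RtoC 1)%C).
split; intros (? & ? & ?); repeat split; nra.
Qed.

(** * The trapping region *)

(** At [N = |z|^2], [x = Re z], [t = 1] this is a hyperbolic half-plane.  The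
    inequality is homogeneous because the image of a point under a
    trisection map is known only up to the factor that normalizes its
    longest side. *)
Definition half_plane (A B E N x t : R) : Prop := 0 <= A * N + B * x + E * t.

(** The corners, counted from the left along the lower boundary, have
    [(x, N)] equal to [(1/14, 1/7)], [(1/6, 1/9)] (reflex), [(5/26, 1/13)],
    [(13/42, 1/9)], [(5/14, 1/7)] (reflex), [(7/18, 13/81)], [(29/62, 7/31)],
    [(1/2, 7/27)]; the remaining corner [(1/2, 1)] is [z_eq].  With [or] for
    [join] this is the polygon; with [and] it is the set of points from which
    one sees all of the polygon. *)
Definition region (join : Prop -> Prop -> Prop) (N x t : R) : Prop :=
  half_plane 0 (-2) 1 N x t /\ half_plane (-1) 2 0 N x t /\
  half_plane 48 (-14) (-1) N x t /\ half_plane 99 (-82) 16 N x t /\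
  half_plane 27 (-28) 7 N x t /\
  join (half_plane 6 2 (-1) N x t) (half_plane 3 4 (-1) N x t) /\
  join (half_plane 21 (-14) 2 N x t) (half_plane 18 (-10) 1 N x t).

Definition trapped (z : C) : Prop :=
  0 < Im z /\ region or (sqnorm z) (Re z) 1.

Definition core (z : C) : Prop :=
  0 < Im z /\ region and (sqnorm z) (Re z) 1.

Lemma core_trapped (z : C) : core z -> trapped z.
Proof. unfold core, trapped, region; tauto. Qed.

Lemma half_plane_scale (A B E N x t k : R) : 0 < k ->
  half_plane A B E (k * N) (k * x) (k * t) -> half_plane A B E N x t.
Proof. unfold half_plane; intros Hk H; nra. Qed.

Lemma region_or_scale (N x t k : R) : 0 < k ->
  region or (k * N) (k * x) (k * t) -> region or N x t.
Proof.
unfold region; intros Hk H; decompose [and or] H;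
  repeat split; eauto using half_plane_scale.
Qed.

(** The sides [s], [m], [l] of a normalized triangle come in increasing order,
    while [p], [q], [r] carry the labels of the vertices. *)
Definition rearranged (p q r s m l : R) : Prop :=
  s = p /\ m = q /\ l = r \/ s = p /\ m = r /\ l = q \/
  s = q /\ m = p /\ l = r \/ s = q /\ m = r /\ l = p \/
  s = r /\ m = p /\ l = q \/ s = r /\ m = q /\ l = p.

(** Here [s], [s - 2 * X + l] and [l] are the squared sides of the normalized
    image scaled by [l], so [(s, X, l)] are homogeneous coordinates of that
    image; [k] selects the left, middle or right triangle.  The two final
    hypotheses say that the sides are sorted.  Once the order of the sides
    and the alternatives that hold at the reflex corners are chosen, all data
    are linear in [N] and [x]; the conclusion being a disjunction at each
    reflex corner, one proves the second alternative where the first one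
    fails. *)
Lemma trisection_trapped (N x s X l k : R) :
  k = 0 \/ k = 1 \/ k = 2 ->
  region or N x 1 ->
  rearranged (1 / 9) (N - 2 * (k / 3) * x + (k / 3) ^ 2)
    (N - 2 * ((k + 1) / 3) * x + ((k + 1) / 3) ^ 2)
    s (s - 2 * X + l) l ->
  0 <= l - 2 * X -> 0 <= 2 * X - s -> region or s X l.
Proof.
unfold region, half_plane, rearranged.
intros Hk (H1 & H2 & H3 & H4 & H5 & H6 & H7) Hr G1 G2.
destruct Hk as [-> | [-> | ->]]; destruct H6, H7;
  decompose [and or] Hr;
  repeat split;
  try match goal with
  | |- 0 <= ?a \/ 0 <= ?b =>
      destruct (Rle_or_lt 0 a); [left; assumption | right]
  end; lra.
Qed.

(** * Normalization *)

(** A similarity multiplies squared distances by a constant, and its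
    injectivity forces the three vertices to be matched bijectively.  Which
    bijection occurs is recovered from the order of the sides. *)
Lemma normalized_form_sides (a b c w : C) :
  normalized_form a b c w ->
  exists k : R, 0 < k /\
    rearranged (sqdist a b) (sqdist c a) (sqdist c b)
      (k * sqnorm w) (k * (sqnorm w - 2 * Re w + 1)) k.
Proof.
intros [(Hy & _) [f [[q [Hq Hf]] Hv]]].
exists (q ^ 2); split; [nra |].
assert (Hd : forall u v, sqdist (f u) (f v) = q ^ 2 * sqdist u v).
{ intros u v; unfold sqdist; rewrite Hf; ring. }
assert (E1 : sqdist (f (RtoC 1)) (f (RtoC 0)) = q ^ 2).
{ rewrite Hd, sqdist_coords; cbn; ring. }
assert (E2 : sqdist (f w) (f (RtoC 0)) = q ^ 2 * sqnorm w).
{ rewrite Hd, sqdist_real; ring. }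
assert (E3 : sqdist (f w) (f (RtoC 1)) = q ^ 2 * (sqnorm w - 2 * Re w + 1)).
{ rewrite Hd, sqdist_real; ring. }
assert (P0 : 0 < q ^ 2) by nra.
assert (P2 : 0 < q ^ 2 * sqnorm w).
{ apply Rmult_lt_0_compat; [lra | unfold sqnorm; nra]. }
assert (P3 : 0 < q ^ 2 * (sqnorm w - 2 * Re w + 1)).
{ apply Rmult_lt_0_compat; [lra | unfold sqnorm].
  pose proof (pow2_ge_0 (Re w - 1)); nra. }
assert (V : forall x, vertex (RtoC 0) (RtoC 1) w x -> vertex a b c (f x)).
{ intros x Hx; apply Hv; now exists x. }
assert (V0 := V (RtoC 0) (or_introl eq_refl)).
assert (V1 := V (RtoC 1) (or_intror (or_introl eq_refl))).
assert (Vw := V w (or_intror (or_intror eq_refl))).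
clear Hv V Hd Hf.
generalize dependent (q ^ 2 * (sqnorm w - 2 * Re w + 1)).
generalize dependent (q ^ 2 * sqnorm w).
generalize dependent (q ^ 2).
intros l El Pl s Es Ps m Em Pm.
rewrite (sqdist_sym a b).
destruct V0 as [V0 | [V0 | V0]]; destruct V1 as [V1 | [V1 | V1]];
  destruct Vw as [Vw | [Vw | Vw]];
  rewrite V1, V0 in El; rewrite Vw, V0 in Es; rewrite Vw, V1 in Em;
  try (exfalso; rewrite sqdist_self in El; lra);
  try (exfalso; rewrite sqdist_self in Es; lra);
  try (exfalso; rewrite sqdist_self in Em; lra);
  rewrite ?(sqdist_sym a b), ?(sqdist_sym a c), ?(sqdist_sym b c) in El;
  rewrite ?(sqdist_sym a b), ?(sqdist_sym a c), ?(sqdist_sym b c) in Es;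
  rewrite ?(sqdist_sym a b), ?(sqdist_sym a c), ?(sqdist_sym b c) in Em;
  rewrite El, Es, Em; unfold rearranged; tauto.
Qed.

Lemma trapped_normalized (k : R) (z w : C) :
  k = 0 \/ k = 1 \/ k = 2 -> trapped z ->
  normalized_form (RtoC (k / 3)) (RtoC ((k + 1) / 3)) z w -> trapped w.
Proof.
intros Hk [_ Hz] Hw.
assert (HS : Sigma w) by apply Hw.
apply Sigma_coords in HS; destruct HS as (Hy & H1 & H2).
destruct (normalized_form_sides _ _ _ _ Hw) as (q & Hq & Hr).
split; [exact Hy |].
apply (region_or_scale _ _ _ q Hq).
apply (trisection_trapped (sqnorm z) (Re z) _ _ _ k Hk Hz); [| nra | nra].
replace (sqdist (RtoC (k / 3)) (RtoC ((k + 1) / 3))) with (1 / 9) in Hr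
  by (rewrite sqdist_coords; cbn; field).
rewrite !sqdist_real in Hr.
replace (q * sqnorm w - 2 * (q * Re w) + q * 1)
  with (q * (sqnorm w - 2 * Re w + 1)) by ring.
rewrite Rmult_1_r; exact Hr.
Qed.

Lemma orbit_trapped (z w : C) : trapped z -> orbit z w -> trapped w.
Proof.
intros Hz; induction 1 as [| u w _ IH Hw | u w _ IH Hw | u w _ IH Hw];
  [exact Hz | | |].
- apply (trapped_normalized 0 u); auto.
  replace (0 / 3) with 0 by field; replace ((0 + 1) / 3) with (1 / 3) by field.
  exact Hw.
- exact (trapped_normalized 1 u w (or_intror (or_introl eq_refl)) IH Hw).
- apply (trapped_normalized 2 u); auto.
  replace ((2 + 1) / 3) with 1 by field; exact Hw.
Qed.

Lemma z_eq_trapped : trapped z_eq.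
Proof.
assert (H : sqrt 3 ^ 2 = 3) by (apply pow2_sqrt; lra).
assert (0 < sqrt 3) by (apply sqrt_lt_R0; lra).
unfold trapped, sqnorm, region, half_plane, z_eq; cbn [Re Im fst snd].
replace ((sqrt 3 / 2) ^ 2) with (3 / 4) by (unfold Rdiv; rewrite Rpow_mult_distr, H; field).
repeat split; try lra; left; lra.
Qed.

(** * Discs and geodesic cones *)

(** Since [e^r = sqrt 2], the imaginary parts in the disc range from [h] to
    [2 * h], which is why centres [a + i h sqrt 2] give Euclidean discs
    without irrational data. *)
Lemma hdisc_euclidean (a h : R) (z : C) : 0 < h ->
  hdisc (a, h * sqrt 2) (ln (sqrt 2)) z ->
  0 < Im z /\ (Re z - a) ^ 2 + (Im z - 3 / 2 * h) ^ 2 <= (h / 2) ^ 2.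
Proof.
intros Hh [Hz Hd]; split; [exact Hz |].
set (o := (a, h * sqrt 2) : C) in *.
assert (H2 : 0 < sqrt 2) by (apply sqrt_lt_R0; lra).
assert (H22 : sqrt 2 * sqrt 2 = 2) by (apply sqrt_sqrt; lra).
assert (Ho : 0 < Im o) by (cbn; nra).
unfold hdist, arcosh in Hd; fold (sqdist z o) in Hd.
assert (HP : 0 < 2 * Im z * Im o) by nra.
assert (HX : 0 <= sqdist z o / (2 * Im z * Im o)).
{ apply Rdiv_le_0_compat; [apply pow2_ge_0 | exact HP]. }
assert (HE : sqdist z o
  = sqdist z o / (2 * Im z * Im o) * (2 * Im z * Im o)) by (field; lra).
rewrite sqdist_coords in HE at 1.
set (t := sqdist z o / (2 * Im z * Im o)) in *.
pose proof (sqrt_pos ((1 + t) ^ 2 - 1)) as Hs.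
assert (Hss := sqrt_sqrt ((1 + t) ^ 2 - 1) ltac:(nra)).
set (s := sqrt ((1 + t) ^ 2 - 1)) in *.
assert (Hle : 1 + t + s <= sqrt 2).
{ destruct (Rle_or_lt (1 + t + s) (sqrt 2)) as [H | H]; [exact H |].
  apply ln_increasing in H; lra. }
assert (Ht : 4 * (1 + t) <= 3 * sqrt 2) by nra.
assert (HB : t * (2 * Im z * Im o)
  <= (3 * sqrt 2 / 4 - 1) * (2 * Im z * Im o)) by (apply Rmult_le_compat_r; lra).
rewrite <- HE in HB; cbn [o Re Im fst snd] in HB.
replace ((3 * sqrt 2 / 4 - 1) * (2 * Im z * (h * sqrt 2)))
  with (3 / 2 * (sqrt 2 * sqrt 2) * Im z * h - 2 * Im z * (h * sqrt 2))
  in HB by field.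
replace ((Im z - h * sqrt 2) ^ 2)
  with (Im z ^ 2 - 2 * Im z * (h * sqrt 2) + h ^ 2 * (sqrt 2 * sqrt 2))
  in HB by ring.
rewrite H22 in HB; lra.
Qed.

(** In the coordinates [|z - a|^2] and [x - a] the disc is an ellipse with vertices at
    its bottom point [a + i h] and its top point [a + 2 i h], where the affine
    form takes the values [p] and [q].  On the disc, [x - a] is at most a
    multiple of the geometric mean of the distances to the two vertices,
    so the inequality of the arithmetic and geometric means compares the form
    with the interpolation of [p] and [q].  The condition on [4 * p * q] says
    that the form is nonnegative on the ellipse. *)
Lemma half_plane_disc (A B E a h x y : R) : 0 < h ->
  let p := A * (a ^ 2 + h ^ 2) + B * a + E in
  let q := A * (a ^ 2 + (2 * h) ^ 2) + B * a + E in
  0 <= p -> 0 <= q -> (h * (2 * a * A + B)) ^ 2 <= 4 * p * q ->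
  (x - a) ^ 2 + (y - 3 / 2 * h) ^ 2 <= (h / 2) ^ 2 ->
  half_plane A B E (x ^ 2 + y ^ 2) x 1.
Proof.
intros Hh p q Hp Hq Hpq Hz; unfold half_plane.
(* [M] is [N] after the translation that moves [a] to the origin; it runs
   from [h ^ 2] at the bottom to [4 * h ^ 2] at the top. *)
set (M := (x - a) ^ 2 + y ^ 2).
assert (Hy : M <= 3 * h * y - 2 * h ^ 2) by (unfold M; nra).
assert (Hh2 : 0 < h ^ 2) by nra.
assert (HM0 : 0 <= M)
  by (unfold M; pose proof (pow2_ge_0 (x - a)); pose proof (pow2_ge_0 y); lra).
assert (HX : 9 * h ^ 2 * (x - a) ^ 2 <= (4 * h ^ 2 - M) * (M - h ^ 2)).
{ assert ((M + 2 * h ^ 2) ^ 2 <= (3 * h * y) ^ 2) by (apply pow_incr; lra).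
  replace ((x - a) ^ 2) with (M - y ^ 2) by (unfold M; ring); lra. }
assert (HX0 : 0 <= 9 * h ^ 2 * (x - a) ^ 2)
  by (apply Rmult_le_pos; [lra | apply pow2_ge_0]).
assert (HM : h ^ 2 <= M <= 4 * h ^ 2) by (split; nra).
set (U := p * (4 * h ^ 2 - M) + q * (M - h ^ 2)).
set (W := 3 * h ^ 2 * (2 * a * A + B) * (x - a)).
assert (HU : 0 <= U)
  by (unfold U; apply Rplus_le_le_0_compat; apply Rmult_le_pos; lra).
assert (HW : W ^ 2 <= U ^ 2).
{ apply Rle_trans with ((h * (2 * a * A + B)) ^ 2 * (9 * h ^ 2 * (x - a) ^ 2)).
  { unfold W; right; ring. }
  apply Rle_trans with (4 * p * q * ((4 * h ^ 2 - M) * (M - h ^ 2))).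
  { apply Rmult_le_compat; auto using pow2_ge_0. }
  unfold U; pose proof (pow2_ge_0 (p * (4 * h ^ 2 - M) - q * (M - h ^ 2))); lra. }
assert (HUW : 0 <= U + W) by nra.
assert (HE : U + W = 3 * h ^ 2 * (A * (x ^ 2 + y ^ 2) + B * x + E * 1))
  by (unfold U, W, p, q, M; ring).
nra.
Qed.

Lemma disc_core (z : C) : D1 z \/ D2 z \/ D3 z -> core z.
Proof.
unfold D1, D2, D3, omega1, omega2, omega3.
replace (sqrt 2 / 3) with (1 / 3 * sqrt 2) by field.
replace (sqrt 2 / 6) with (1 / 6 * sqrt 2) by field.
replace (sqrt 2 / 9) with (1 / 9 * sqrt 2) by field.
intros [H | [H | H]]; (apply hdisc_euclidean in H; [| lra]);
  destruct H as [Hy H]; (split; [exact Hy |]);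
  repeat split; (eapply half_plane_disc; [| | | | exact H]); lra.
Qed.

Lemma between_affine (a b x : R) : between a b x ->
  exists t, 0 <= t <= 1 /\ x = (1 - t) * a + t * b.
Proof.
intros H; destruct (Req_dec a b) as [<- | Hab].
- exists 0; unfold between in H; lra.
- exists ((x - a) / (b - a)); split; [| field; lra].
  assert (E : x - a = (x - a) / (b - a) * (b - a)) by (field; lra).
  set (t := (x - a) / (b - a)) in *.
  destruct H, (Rtotal_order a b) as [? | [? | ?]]; split; nra.
Qed.

(** On a half-circle with real centre [m] and radius [r] one has
    [N = 2 * m * x + r ^ 2 - m ^ 2], which is affine in [x]; on a vertical line
    [x] is constant and [N] increases with the imaginary part. *)
Lemma geodesic_affine (p q z : C) : geodesic_segment p q z ->
  exists t, 0 <= t <= 1 /\ Re z = (1 - t) * Re p + t * Re q /\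
    sqnorm z = (1 - t) * sqnorm p + t * sqnorm q.
Proof.
intros (Hp & Hq & Hz & [(E & Ez & Hb) | (m & r & Hr & Ep & Eq & Ez & Hb)]).
- assert (HN : between (sqnorm p) (sqnorm q) (sqnorm z)).
  { unfold between, sqnorm in *; rewrite Ez, <- E; destruct Hb; [left | right]; nra. }
  destruct (between_affine _ _ _ HN) as (t & Ht & HE).
  exists t; repeat split; try lra; rewrite Ez, <- E; ring.
- destruct (between_affine _ _ _ Hb) as (t & Ht & HE).
  exists t; repeat split; try lra.
  pose proof (sqdist_real p m) as Fp; pose proof (sqdist_real q m) as Fq;
    pose proof (sqdist_real z m) as Fz; unfold sqdist in Fp, Fq, Fz.
  rewrite Ep in Fp; rewrite Eq in Fq; rewrite Ez, HE in Fz.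
  replace (sqnorm p) with (r ^ 2 + 2 * m * Re p - m ^ 2) by lra.
  replace (sqnorm q) with (r ^ 2 + 2 * m * Re q - m ^ 2) by lra.
  nra.
Qed.

Lemma half_plane_convex (A B E : R) (p q z : C) :
  geodesic_segment p q z ->
  half_plane A B E (sqnorm p) (Re p) 1 ->
  half_plane A B E (sqnorm q) (Re q) 1 ->
  half_plane A B E (sqnorm z) (Re z) 1.
Proof.
unfold half_plane; intros Hg Hp Hq.
destruct (geodesic_affine _ _ _ Hg) as (t & Ht & -> & ->).
nra.
Qed.

(** At each reflex corner the half-plane that contains [p] also contains [q],
    hence the whole segment. *)
Lemma segment_trapped (p q z : C) :
  trapped p -> core q -> geodesic_segment p q z -> trapped z.
Proof.
intros [_ Hp] [_ Hq] Hg.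
split; [apply Hg |].
unfold region in *; decompose [and or] Hp; decompose [and] Hq;
  repeat split; eauto using half_plane_convex.
Qed.

Lemma Omega1_trapped (z : C) : Omega1 z -> trapped z.
Proof.
intros [H | (p & Hp & _ & H)]; [now apply core_trapped, disc_core |].
apply (orbit_trapped _ _ z_eq_trapped) in Hp.
destruct H as [(q & Hq & Hg) | [(q & Hq & Hg) | (q & Hq & Hg)]];
  apply (segment_trapped p q z Hp); auto using disc_core.
Qed.

(** * Angles *)

Definition gamma_max : R := acos (- 5 / (2 * sqrt 7)).

(** The function [acos] is constant on each side of [[-1, 1]], so it is monotone
    on the whole line; this avoids proving that the quotients below are cosines. *)
Lemma acos_antitone (x y : R) : x <= y -> acos y <= acos x.
Proof.
intros Hxy; pose proof (acos_bound x) as Bx; pose proof (acos_bound y) as By.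
destruct (Rle_or_lt x (-1)) as [Hx | Hx].
{ replace (acos x) with PI; [lra |].
  unfold acos; destruct (Rle_dec x (-1)); lra. }
destruct (Rle_or_lt 1 y) as [Hy | Hy].
{ replace (acos y) with 0; [lra |].
  unfold acos; destruct (Rle_dec y (-1)); [lra |].
  destruct (Rle_dec 1 y); lra. }
apply cos_decr_0; try lra; rewrite !cos_acos; lra.
Qed.

Lemma angle_law_of_cosines (a b c : C) :
  angle a b c = acos ((sqdist b a + sqdist c a - sqdist b c)
    / (2 * (Cmod (b - a)%C * Cmod (c - a)%C))).
Proof.
unfold angle; f_equal; rewrite !sqdist_coords.
replace (Re ((b - a) * Cconj (c - a))%C) with
  (((Re b - Re a) ^ 2 + (Im b - Im a) ^ 2
    + ((Re c - Re a) ^ 2 + (Im c - Im a) ^ 2)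
    - ((Re b - Re c) ^ 2 + (Im b - Im c) ^ 2)) / 2)
  by (destruct a, b, c; cbn; field).
unfold Rdiv; rewrite !Rinv_mult; ring.
Qed.

Lemma angle_le_gamma_max (a b c : C) :
  0 < sqdist b a -> 0 < sqdist c a ->
  let n := sqdist b a + sqdist c a - sqdist b c in
  0 <= n \/ 7 * n ^ 2 <= 25 * (sqdist b a * sqdist c a) ->
  angle a b c <= gamma_max.
Proof.
intros Hb Hc n Hn; rewrite angle_law_of_cosines; fold n.
apply acos_antitone.
assert (HP2 : (Cmod (b - a)%C * Cmod (c - a)%C) ^ 2 = sqdist b a * sqdist c a)
  by (unfold sqdist; ring).
assert (HP0 : 0 <= Cmod (b - a)%C * Cmod (c - a)%C)
  by (apply Rmult_le_pos; apply Cmod_ge_0).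
set (P := Cmod (b - a)%C * Cmod (c - a)%C) in *.
assert (HPp : 0 < sqdist b a * sqdist c a) by (apply Rmult_lt_0_compat; assumption).
assert (HP : 0 < P) by nra.
assert (Hs : 0 < sqrt 7) by (apply sqrt_lt_R0; lra).
assert (Hss : sqrt 7 ^ 2 = 7) by (apply pow2_sqrt; lra).
assert (H : 0 <= 5 * P + sqrt 7 * n).
{ destruct Hn as [Hn | Hn]; [nra |].
  assert ((sqrt 7 * n) ^ 2 <= (5 * P) ^ 2)
    by (rewrite !Rpow_mult_distr, Hss, HP2; lra).
  nra. }
replace (- 5 / (2 * sqrt 7))
  with (n / (2 * P) - (5 * P + sqrt 7 * n) / (2 * P * sqrt 7)) by (field; lra).
assert (0 <= (5 * P + sqrt 7 * n) / (2 * P * sqrt 7)); [| lra].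
apply Rdiv_le_0_compat; [exact H | nra].
Qed.

(** With [y ^ 2 = N - x ^ 2] the claim is [25 * y ^ 2 >= 3 * (x - N) ^ 2],
    the outside of the arc through [0] and [1] that sees them under the angle
    [gamma_max].  Its left side minus its right side is a concave quadratic
    in [(x, N)], so along each of the four last lines that bound the convex
    hull from below, the leftmost one prolonged to [x = 0], it is enough to look at
    the endpoints, with equality at [x = 29 / 62]. *)
Lemma apex_cosine_bound (N x : R) :
  0 < N - x ^ 2 -> region or N x 1 -> N < x ->
  7 * (2 * N - 2 * x) ^ 2 <= 25 * (N * (N - 2 * x + 1)).
Proof.
intros Hy (H1 & H2 & H3 & H4 & H5 & H6 & H7) HNx.
unfold half_plane in *.
(* The side of the convex hull from [x = 13 / 42] to [x = 7 / 18], below the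
   reflex corner between them. *)
assert (H8 : 0 <= 135 * N - 84 * x + 11) by (destruct H7; lra).
clear H6 H7.
enough (0 <= 25 * (N - x ^ 2) - 3 * (x - N) ^ 2) by lra.
(* [m] is the value of [x - N] on the lower line over the interval from [l]
   to [r]; the expression decreases in [x - N] as long as [N < x]. *)
assert (chord : forall l r m, x - N <= m -> 0 <= (x - l) * (r - x) ->
  (0 <= (x - l) * (r - x) -> 0 <= 25 * (x - x ^ 2) - 25 * m - 3 * m ^ 2) ->
  0 <= 25 * (N - x ^ 2) - 3 * (x - N) ^ 2).
{ intros l r m Hm Hlr Hq; specialize (Hq Hlr).
  assert ((x - N) ^ 2 <= m ^ 2) by (apply pow_incr; lra).
  lra. }
destruct (Rle_or_lt x (13 / 42)); [| destruct (Rle_or_lt x (7 / 18));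
  [| destruct (Rle_or_lt x (29 / 62))]].
{ apply (chord 0 (13 / 42) (x - (14 * x + 1) / 48)); [lra | nra | lra]. }
{ apply (chord (13 / 42) (7 / 18) (x - (84 * x - 11) / 135)); [lra | nra | lra]. }
{ apply (chord (7 / 18) (29 / 62) (x - (82 * x - 16) / 99)); [lra | nra | lra]. }
apply (chord (29 / 62) (1 / 2) (x - (28 * x - 7) / 27)); [lra | nra | lra].
Qed.

Lemma trapped_Sigma (z : C) : trapped z -> Sigma z.
Proof.
intros (Hy & H1 & H2 & _); unfold half_plane in *.
apply Sigma_coords; lra.
Qed.

(** Only the apex can be obtuse: [0 <= Re z <= 1 / 2] makes the cosines at [0]
    and [1] nonnegative. *)
Lemma trapped_angle_le (z : C) : trapped z -> largest_angle z <= gamma_max.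
Proof.
intros [Hy Hz].
assert (HN : 0 < sqnorm z - Re z ^ 2) by (unfold sqnorm; nra).
assert (Hx : sqnorm z <= 2 * Re z /\ 2 * Re z <= 1)
  by (destruct Hz as (? & ? & _); unfold half_plane in *; lra).
pose proof (pow2_ge_0 (Re z)); pose proof (pow2_ge_0 (Re z - 1)).
assert (E0 : sqdist z (RtoC 0) = sqnorm z) by (rewrite sqdist_real; ring).
assert (E1 : sqdist z (RtoC 1) = sqnorm z - 2 * Re z + 1)
  by (rewrite sqdist_real; ring).
assert (E2 : sqdist (RtoC 1) (RtoC 0) = 1) by (rewrite sqdist_coords; cbn; ring).
unfold largest_angle; repeat apply Rmax_lub; apply angle_le_gamma_max; cbv zeta;
  rewrite ?(sqdist_sym (RtoC 0) z), ?(sqdist_sym (RtoC 1) z),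
    ?(sqdist_sym (RtoC 0) (RtoC 1)), ?E0, ?E1, ?E2;
  try lra; try (left; lra).
destruct (Rlt_or_le (sqnorm z) (Re z)) as [Hlt | Hge]; [right | left; lra].
pose proof (apex_cosine_bound _ _ HN Hz Hlt); lra.
Qed.

(** The side opposite to [z] is a longest one.  By the law of cosines the bound
    [1 / 2] on the cosine at [z] amounts to [N + M - 1 <= sqrt (N * M)] for the
    other two squared sides [N <= M <= 1]. *)
Lemma Sigma_angle_ge (z : C) : Sigma z -> PI / 3 <= largest_angle z.
Proof.
intros (Hy & H1 & H2)%Sigma_coords.
apply Rle_trans with (angle z (RtoC 0) (RtoC 1));
  [| unfold largest_angle; eauto using Rmax_r, Rle_trans].
replace (PI / 3) with (acos (1 / 2))
  by (rewrite <- cos_PI3; apply acos_cos; pose proof PI_RGT_0; lra).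
rewrite angle_law_of_cosines; apply acos_antitone.
assert (E0 : sqdist (RtoC 0) z = sqnorm z) by (rewrite sqdist_sym, sqdist_real; ring).
assert (E1 : sqdist (RtoC 1) z = sqnorm z - 2 * Re z + 1)
  by (rewrite sqdist_sym, sqdist_real; ring).
assert (E2 : sqdist (RtoC 0) (RtoC 1) = 1) by (rewrite sqdist_coords; cbn; ring).
assert (HN : 0 < sqnorm z) by (unfold sqnorm; nra).
set (P := Cmod (RtoC 0 - z)%C * Cmod (RtoC 1 - z)%C).
assert (HP2 : P ^ 2 = sqnorm z * (sqnorm z - 2 * Re z + 1))
  by (rewrite <- E1, <- E0; unfold P, sqdist; ring).
assert (HP0 : 0 <= P) by (apply Rmult_le_pos; apply Cmod_ge_0).
assert (HP : sqnorm z <= P) by nra.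
rewrite E0, E1, E2; apply Rle_div_l; lra.
Qed.

Theorem theorem4 :
  forall z z' : C, Omega1 z -> orbit z z' ->
    largest_angle z' <=
      (acos (- 5 / (2 * sqrt 7)) / (PI / 3)) * largest_angle z.
Proof.
intros z z' Hz Ho; apply Omega1_trapped in Hz.
assert (Hup := trapped_angle_le z' (orbit_trapped z z' Hz Ho)).
assert (Hlow : PI / 3 <= largest_angle z) by (apply Sigma_angle_ge, trapped_Sigma, Hz).
fold gamma_max.
pose proof PI_RGT_0.
assert (Hg : 0 <= gamma_max) by apply acos_bound.
replace gamma_max with (gamma_max / (PI / 3) * (PI / 3)) in Hup by (field; lra).
apply Rle_trans with (1 := Hup); apply Rmult_le_compat_l; [| exact Hlow].
apply Rdiv_le_0_compat; lra.
Qed.
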